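(* Let $N\ge1$ and $k\in\{0,1,\dots,N-1\}$. If $E\subseteq\mathbb R^N$ is $k$-dimensionally absolute winning, then $E$ is $\frac{N-k}{N}$-Cantor-winning with respect to the canonical splitting structure of $\mathbb R^N$.
   Context: $\mathbb R^N$ carries the metric $|x-y|_\infty$; its closed balls are cubes (''boxes''), with $\mathrm{rad}(B)$ half the side length. The canonical splitting structure: for $u\in\mathbb N$, $\mathcal S(B,u)$ is the set of $u^N$ closed subcubes obtained by dividing the cube $B$ into $u^N$ equal cubes of side length $1/u$ times that of $B$; $f(u)=u^N$. $k$-dimensional absolute game with parameter $\beta\in(0,1/3)$: Bob chooses a box $B_1$; for $i=1,2,\dots$, Alice chooses $\delta_i\le\beta$ and a $k$-dimensional affine subspace $\mathcal L_i$, and sets $A_i:=B_i\cap\{x:\inf_{y\in\mathcal L_i}|x-y|_\infty<\delta_i\,\mathrm{rad}(B_i)\}$; Bob then chooses a box $B_{i+1}\subseteq B_i\setminus A_i$ with $\mathrm{rad}(B_{i+1})\ge\beta\,\mathrm{rad}(B_i)$. $E$ is $k$-dimensionally $\beta$-absolute winning if Alice has a strategy guaranteeing $\bigcap_iB_i\cap E\neq\emptyset$; $E$ is $k$-dimensionally absolute winning if this holds for every $\beta\in(0,1/3)$. Generalised Cantor sets: given a box $B$, $R\in\mathbb N$ and reals $\mathbf r=(r_{m,n})_{0\le m\le n}$, set $\mathcal B_0=\{B\}$; given $\mathcal B_n$, let $\mathcal I_{n+1}=\bigcup_{B_n\in\mathcal B_n}\mathcal S(B_n,R)$, $\mathcal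 I^{n+1}_{n+1}:=\mathcal I_{n+1}$, and for $j=0,\dots,n$ obtain $\mathcal I^{n-j}_{n+1}\subseteq\mathcal I^{n-j+1}_{n+1}$ by removing, for each $B_{n-j}\in\mathcal B_{n-j}$, at most $r_{n-j,n}$ boxes from $\mathcal S(B_{n-j},R^{j+1})\cap\mathcal I^{n-j+1}_{n+1}$; put $\mathcal B_{n+1}:=\mathcal I^0_{n+1}$. Any resulting $\bigcap_n\bigcup_{b\in\mathcal B_n}b$ is a $(B,R,\mathbf r)$-Cantor set. $K$ is $\epsilon_0$-Cantor-winning if for every box $B$ and every $0<\epsilon<\epsilon_0$ there is $R_\epsilon$ such that for every integer $R\ge R_\epsilon$, $K$ contains some $(B,R,\mathbf r)$-Cantor set with $r_{m,n}=f(R)^{(n-m+1)(1-\epsilon)}$ for all $0\le m\le n$. *)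

(* Defs.v *)
From HB Require Import structures.
From mathcomp Require Import all_boot all_order all_algebra.
From mathcomp Require Import all_classical all_reals all_analysis.

Set Implicit Arguments.
Unset Strict Implicit.
Unset Printing Implicit Defensive.

Import Order.TTheory GRing.Theory Num.Theory.
Import numFieldNormedType.Exports.

Local Open Scope classical_set_scope.
Local Open Scope ring_scope.

Section Boxes.
Variables (R : realType) (N : nat).

(* The norm `|_| of 'rV[R]_N is the sup norm. For 0 < N a closed ball
   determines its center and radius, so equality of boxes is equality of the
   underlying sets. *)
Record box := Box {
  box_center : 'rV[R]_N ;
  box_rad : R ;
  box_rad_gt0 : 0 < box_rad }.

Definition box_set (B : box) : set 'rV[R]_N :=
  [set x | `|x - box_center B| <= box_rad B].

(* The j-th side of the subcube with index i is
   [c_j - r + 2 r i_j / u, c_j - r + 2 r (i_j + 1) / u]. *)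
Definition subcube_center (B : box) (u : nat) (i : 'I_N -> 'I_u) : 'rV[R]_N :=
  \row_j (box_center B 0 j - box_rad B + box_rad B * ((i j).*2.+1)%:R / u%:R).

Definition canonical_splitting (B : box) (u : nat) : set box :=
  [set b | box_rad b = box_rad B / u%:R /\ exists i, box_center b = @subcube_center B u i].

Definition splitting_size (u : nat) : nat := (u ^ N)%N.

End Boxes.

Section AbsoluteGame.
Variables (R : realType) (N : nat).
Local Notation box := (box R N).

Definition affine_subspace (k : nat) (L : set 'rV[R]_N) : Prop :=
  exists (p : 'rV[R]_N) (V : {vspace 'rV[R]_N}),
    \dim V = k /\ L = [set p + v | v in [set v | v \in V]].

Definition dist_set (x : 'rV[R]_N) (L : set 'rV[R]_N) : R :=
  inf [set `|x - y| | y in L].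

Record alice_move := AliceMove {
  move_delta : R ;
  move_space : set 'rV[R]_N }.

Definition legal_move (k : nat) (beta : R) (a : alice_move) : Prop :=
  move_delta a <= beta /\ affine_subspace k (move_space a).

Definition deleted (B : box) (a : alice_move) : set 'rV[R]_N :=
  box_set B `&` [set x | dist_set x (move_space a) < move_delta a * box_rad B].

(* A strategy answers the list of the boxes played so far by Bob, oldest first;
   Alice's earlier moves are determined by it. *)
Definition strategy := seq box -> alice_move.

Definition answer (s : strategy) (B : nat -> box) (i : nat) : alice_move :=
  s (mkseq B i.+1).

Definition bob_plays_against (beta : R) (s : strategy) (B : nat -> box) : Prop :=
  forall i,
    box_set (B i.+1) `<=` box_set (B i) `\` deleted (B i) (answer s B i) /\
    beta * box_rad (B i) <= box_rad (B i.+1).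

Definition beta_absolute_winning (k : nat) (beta : R) (E : set 'rV[R]_N) : Prop :=
  exists s : strategy,
    (forall h, legal_move k beta (s h)) /\
    forall B : nat -> box, bob_plays_against beta s B ->
      (\bigcap_i box_set (B i)) `&` E !=set0.

Definition absolute_winning (k : nat) (E : set 'rV[R]_N) : Prop :=
  forall beta : R, 0 < beta -> beta < 3%:R^-1 -> beta_absolute_winning k beta E.

End AbsoluteGame.

Section CantorWinning.
Variables (R : realType) (N : nat).
Local Notation box := (box R N).

Definition card_at_most (T : Type) (A : set T) (r : R) : Prop :=
  exists n : nat, (A #<= `I_n)%card /\ n%:R <= r.

(* [I'] arises from [I] by removing, for each [b] in [Bm], at most [r] boxes of
   [canonical_splitting b u `&` I]. *)
Definition removal (Bm : set box) (u : nat) (r : R) (I I' : set box) : Prop :=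
  exists D : box -> set box,
    (forall b, Bm b ->
       D b `<=` canonical_splitting b u `&` I /\ card_at_most (D b) r) /\
    I' = I `\` \bigcup_(b in Bm) D b.

(* [Bs n] is the n-th collection of boxes of the construction and [I n m] the
   intermediate collection with lower index n.+1 and upper index m. *)
Definition cantor_construction (B : box) (u : nat) (r : nat -> nat -> R)
    (Bs : nat -> set box) : Prop :=
  exists I : nat -> nat -> set box,
    Bs 0%N = [set B] /\
    forall n : nat,
      [/\ I n n.+1 = \bigcup_(b in Bs n) canonical_splitting b u,
          forall m : nat, (m <= n)%N ->
            removal (Bs m) (u ^ (n - m).+1)%N (r m n) (I n m.+1) (I n m)
        & Bs n.+1 = I n 0%N].

Definition is_cantor_set (B : box) (u : nat) (r : nat -> nat -> R)
    (C : set 'rV[R]_N) : Prop :=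
  exists Bs : nat -> set box,
    cantor_construction B u r Bs /\
    C = \bigcap_n \bigcup_(b in Bs n) box_set b.

Definition cantor_winning (eps0 : R) (K : set 'rV[R]_N) : Prop :=
  forall (B : box) (eps : R), 0 < eps -> eps < eps0 ->
    exists u_eps : nat, forall u : nat, (0 < u)%N -> (u_eps <= u)%N ->
      exists C : set 'rV[R]_N,
        is_cantor_set B u
          (fun m n => (splitting_size N u)%:R `^ ((n - m).+1%:R * (1 - eps))) C /\
        C `<=` K.

End CantorWinning.

(* Main.v *)
Require Import Defs.
From mathcomp Require Import all_boot all_order all_algebra.
From mathcomp Require Import all_classical all_reals all_analysis.
From mathcomp Require Import ring lra.

Set Implicit Arguments.
Unset Strict Implicit.
Unset Printing Implicit Defensive.

Import Order.TTheory GRing.Theory Num.Theory.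
Import numFieldNormedType.Exports.

Local Open Scope classical_set_scope.
Local Open Scope ring_scope.

(** Let Alice win the game with [beta = 1 / u] and let Bob play only boxes of the
    [u]-adic grid of [B], so that his moves form a chain of boxes, each one in the
    splitting of the previous one. Discard from the splitting of a box the
    subcubes meeting Alice's answer to the chain leading to that box. A point of
    the resulting Cantor set lies, by Konig's lemma, in every box of one infinite
    legal play, hence is the single point of that play and belongs to [E].
    Alice's answer is the [rad / u]-neighbourhood of a [k]-dimensional affine
    subspace, which is a Lipschitz graph over [k] of the coordinates with a
    constant depending only on [k]; so it meets at most [C * u ^ k] subcubes, and
    [k < N * (1 - eps)] makes this at most [u ^ (N * (1 - eps))] for large [u].
    Thus only the removals with [m = n] are needed. *)

(** * Trees with finite branching, and residues *)

(** With finitely many children, a node with arbitrarily deep descendants has a child with the same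
    property. The codes [child a i] need only cover the children of [a]; some of them may have
    another parent. *)
Lemma konig (T : Type) (F : finType) (par : T -> T) (child : T -> F -> T)
    (Q : nat -> set T) (root : T) :
  (forall a, exists i, a = child (par a) i) ->
  (forall n a, Q n.+1 a -> Q n (par a)) ->
  (forall a, Q 0 a -> a = root) ->
  (forall n, Q n !=set0) ->
  exists f : nat -> T, forall n, Q n (f n) /\ par (f n.+1) = f n.
Proof.
move=> parK Qpar Q0 Qne.
pose good n a := forall m, exists2 a', Q (m + n)%N a' & iter m par a' = a.
have Qiter m n a : Q (m + n)%N a -> Q n (iter m par a).
  by elim: m a => //= m IH a /Qpar /IH; rewrite -iterSr.
have good0 : good 0%N root.
  move=> m; have [a Qa] := Qne m; exists a; first by rewrite addn0.
  by apply/Q0/Qiter; rewrite addn0.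
have goodS n a : good n a -> exists a', good n.+1 a' /\ par a' = a.
  move=> ga; apply: contrapT => none.
  (* [h i] is a depth at which child [i] has no descendant in [Q]; it is arbitrary when [child a i]
     is not a child of [a]. *)
  have /choice[h hP] : forall i : F, exists m, par (child a i) = a ->
      forall a', Q (m + n.+1)%N a' -> iter m par a' <> child a i.
    move=> i; apply: contrapT => hi; apply: none; exists (child a i).
    have pi : par (child a i) = a.
      by apply: contrapT => pi; apply: hi; exists 0%N.
    split=> // m; apply: contrapT => hm; apply: hi; exists m => _ a' Qa' a'E.
    by apply: hm; exists a'.
  (* A descendant of [a] at depth [M.+1] lies below some child [i]; its ancestor [h i] levels below
     that child contradicts the choice of [h i]. *)
  pose M := \max_i h i.
  have [a' Qa' a'E] := ga M.+1.
  have [i iE] := parK (iter M par a').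
  rewrite iterS in a'E; rewrite a'E in iE.
  have hM : (h i <= M)%N by exact: leq_bigmax.
  have pi : par (child a i) = a by rewrite -iE.
  apply: (hP i pi (iter (M - h i) par a')); last by rewrite -iterD subnKC.
  by apply: Qiter; rewrite addnA subnK// addnS -addSn.
have /choice[next nextP] : forall p : nat * T, exists a',
    good p.1 p.2 -> good p.1.+1 a' /\ par a' = p.2.
  move=> [n a]; case: (pselect (good n a)) => [/goodS[a' ?]|?]; first by exists a'.
  by exists a.
pose f := fix f n := if n is m.+1 then next (m, f m) else root.
have gf n : good n (f n).
  by elim: n => [|n IH] //=; have [] := nextP (n, f n) IH.
exists f => n; split; last by have [] := nextP (n, f n) (gf n).
by have [a' Qa' <-] := gf n 0%N.
Qed.

Lemma eq_modn_close d m n :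
  (m < n + d)%N -> (n < m + d)%N -> m = n %[mod d] -> m = n.
Proof.
wlog mn : m n / (m <= n)%N.
  by have [mn|/ltnW nm] := leqP m n => [|IH md nd mod]; [exact|apply/esym/IH].
move=> _ nmd /esym/eqP; rewrite eqn_mod_dvd// => dvd.
apply/eqP; rewrite eqn_leq mn/= -subn_eq0 -leqn0 leqNgt; apply/negP => pos.
by move: dvd; rewrite gtnNdvd// ltn_subLR.
Qed.

(** * The sup norm on linear subspaces *)

Section SupNorm.
Variables (R : realType) (N : nat).
Implicit Types x y v w : 'rV[R]_N.

Lemma coord_le_norm x j : `|x 0 j| <= `|x|.
Proof. by rewrite [leRHS]mx_normrE; exact: (le_bigmax _ _ (ord0, j)). Qed.

Lemma norm_leP x r : 0 <= r -> reflect (forall j, `|x 0 j| <= r) (`|x| <= r).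
Proof.
move=> r0; apply: (iffP idP) => [xr j|xr].
  exact: le_trans (coord_le_norm x j) xr.
rewrite [leLHS]mx_normrE; apply/bigmax_leP; split=> // -[i j] _ /=.
by rewrite (ord1 i).
Qed.

Lemma norm_coord v : v != 0 -> exists j, `|v| = `|v 0 j|.
Proof.
rewrite -normr_eq0 => /mx_norm_neq0[[i j] /=].
by rewrite (ord1 i); exists j.
Qed.

(* Induction: normalise some [v] in [V] to have largest coordinate [v_j = 1],
   add [j] to the coordinates found for the hyperplane section
   [w_j = 0] of [V], and split [w = w_j v + (w - w_j v)]. *)
Lemma controlling_coords k (V : {vspace 'rV[R]_N}) : (\dim V <= k)%N ->
  exists J : {set 'I_N}, (#|J| <= k)%N /\
    forall w (r : R), w \in V -> 0 <= r -> {in J, forall j, `|w 0 j| <= r} ->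
      `|w| <= 3 ^+ k * r.
Proof.
elim: k V => [|k IH] V dV.
  exists finset.set0; rewrite cards0; split=> // w r + r0 _.
  move: dV; rewrite leqn0 dimv_eq0 => /eqP->; rewrite memv0 => /eqP->.
  by rewrite normr0 expr0 mul1r.
have [V0|V0] := eqVneq V 0%VS.
  exists finset.set0; rewrite cards0; split=> // w r; rewrite V0 memv0 => /eqP-> r0 _.
  by rewrite normr0 mulr_ge0// exprn_ge0.
have := memv_pick V; set v := vpick V => vV.
have v0 : v != 0 by rewrite vpick0.
have [j vj] := norm_coord v0.
have vj0 : v 0 j != 0 by rewrite -normr_eq0 -vj normr_eq0.
pose H := lker (linfun (mulmxr (delta_mx j 0 : 'cV[R]_N) : {linear 'rV[R]_N -> 'rV[R]_1})).
have inH w : (w \in H) = (w 0 j == 0).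
  rewrite memv_ker lfunE /= -colE; apply/eqP/eqP => [/rowP/(_ 0)|wj].
    by rewrite !mxE.
  by apply/rowP => i; rewrite !mxE.
have [|J [cJ JP]] := IH (V :&: H)%VS.
  rewrite -ltnS (leq_trans _ dV)// ltnNge; apply/negP => dVH.
  have : (V :&: H)%VS == V by rewrite eqEdim capvSl.
  move=> /eqP VH; have := vV; rewrite -VH memv_cap inH (negPf vj0) andbF//.
exists (j |: J); split.
  by rewrite cardsU1; case: (j \notin J) => //=; rewrite ?add0n// ltnW.
move=> w r wV r0 wJ.
pose t := w 0 j / v 0 j.
have wj : `|w 0 j| <= r by apply: wJ; rewrite setU11.
have tv : `|t *: v| <= r.
  by rewrite normrZ vj -normrM divfK.
(* Subtracting [t *: v], of norm at most [r], doubles the bound on [J]; adding it back costs another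
   [r <= 3 ^ k * r], hence the factor 3 per dimension. *)
have : `|w - t *: v| <= 3 ^+ k * (2 * r).
  apply: JP; first 1 last.
  - by rewrite mulr_ge0.
  - move=> l lJ; rewrite !mxE (le_trans (ler_normB _ _))//.
    rewrite mulr_natl mulr2n lerD//; first by apply: wJ; rewrite setU1r.
    by have := le_trans (coord_le_norm (t *: v) l) tv; rewrite mxE.
  rewrite memv_cap rpredB ?rpredZ//= inH !mxE /t divfK// subrr//.
move=> h; rewrite -[w](subrK (t *: v)).
rewrite (le_trans (ler_normD _ _))// (le_trans (lerD h tv))// exprS.
have : 1 * r <= 3 ^+ k * r by rewrite ler_wpM2r// exprn_ege1// ler1n.
by lra.
Qed.
End SupNorm.

(** * Counting the subcubes near an affine subspace *)

Section Counting.
Variables (R : realType) (N : nat).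

Lemma box_eq (b b' : box R N) :
  box_center b = box_center b' -> box_rad b = box_rad b' -> b = b'.
Proof.
case: b b' => [c r r0] [c' r' r0'] /= cE rE; subst c' r'.
by congr Box; exact: bool_irrelevance.
Qed.

Lemma natr_double_succ (n : nat) : n.*2.+1%:R = 2 * n%:R + 1 :> R.
Proof. by rewrite -natr1 -mul2n natrM. Qed.

(** An empty [L] must be excluded, since [inf] of the empty set is 0 by convention. *)
Lemma dist_set_lt (x : 'rV[R]_N) (L : set 'rV[R]_N) r :
  L !=set0 -> dist_set x L < r -> exists2 y, L y & `|x - y| < r.
Proof.
move=> [p Lp] /inf_lt[|_ [y Ly <-] ?]; last by exists y.
by exists `|x - p|, p.
Qed.

Lemma subcube_centerB (b : box R N) u (i i' : 'I_N -> 'I_u) l :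
  (0 < u)%N ->
  subcube_center b i 0 l - subcube_center b i' 0 l =
  2 * (box_rad b / u%:R) * ((i l)%:R - (i' l)%:R).
Proof.
move=> u0; have u0' : u%:R != 0 :> R by rewrite pnatr_eq0 -lt0n.
by rewrite !mxE !natr_double_succ; field.
Qed.

(* Two cells near [L] with the same [J]-coordinates differ by less than
   [(3 ^ k).*2.+2] in each coordinate, so the [J]-coordinates and all residues
   modulo that number determine the cell. *)
Lemma card_subcubes_near (k u : nat) (b : box R N) (mv : alice_move R N) :
  (0 < u)%N -> legal_move k u%:R^-1 mv ->
  (#|[pred i : {ffun 'I_N -> 'I_u} | `[< exists2 x : 'rV[R]_N,
        (`|x - subcube_center b i| <= box_rad b / u%:R)%R & deleted b mv x >]]|
    <= u ^ k * (3 ^ k).*2.+2 ^ N)%N.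
Proof.
case: mv => d L u0 [/= du [p [V [dV LE]]]].
set M := (3 ^ k).*2.+2.
set h := box_rad b / u%:R.
have u0' : 0 < u%:R :> R by rewrite ltr0n.
have h0 : 0 < h by rewrite divr_gt0// box_rad_gt0.
have [|J [cJ JP]] := @controlling_coords R N k V; first by rewrite dV.
pose code (i : {ffun 'I_N -> 'I_u}) : {ffun {j | j \in J} -> 'I_u} * {ffun 'I_N -> 'I_M} :=
  ([ffun j => i (val j)], [ffun j => inord (i j %% M)]).
apply: (@leq_trans #|{: {ffun {j | j \in J} -> 'I_u} * {ffun 'I_N -> 'I_M}}|); last first.
  rewrite card_prod !card_ffun card_sig !card_ord leq_mul2r; apply/orP; right.
  by rewrite leq_pexp2l.
apply: (leq_card_in code) => i i'; rewrite !inE => iT i'T [cJE cME].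
(* One [h] is the radius of the cell; the other bounds [d * box_rad b], as [d] is at most
   [1 / u]. *)
have near (q : {ffun 'I_N -> 'I_u}) : (exists2 x : 'rV[R]_N,
        `|x - subcube_center b q| <= h & deleted b (AliceMove d L) x) ->
    exists2 y, L y & `|y - subcube_center b q| < 2 * h.
  move=> [x xq [_ /= xL]].
  have [|y Ly xy] := dist_set_lt _ xL.
    by rewrite LE; exists p; exists 0; rewrite ?addr0//= mem0v.
  exists y => //; rewrite -(subrK x y) -addrA (le_lt_trans (ler_normD _ _))//.
  have : d * box_rad b <= h by rewrite /h mulrC ler_wpM2l// ltW// box_rad_gt0.
  by rewrite distrC => dh; lra.
have [y Ly yi] := near _ iT.
have [y' Ly' yi'] := near _ i'T.
have yV : y - y' \in V.
  move: Ly Ly'; rewrite LE => -[v vV <-] [v' v'V <-].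
  by rewrite opprD addrACA subrr add0r rpredB.
have ctr l (z : 'rV[R]_N) (q : {ffun 'I_N -> 'I_u}) :
    `|z - subcube_center b q| < 2 * h ->
    `|z 0 l - subcube_center b q 0 l| < 2 * h.
  by move=> /(le_lt_trans _); apply; have := coord_le_norm (z - subcube_center b q) l; rewrite !mxE.
have yJ : {in J, forall j, `|(y - y') 0 j| <= 4 * h}.
  move=> j jJ; have /ffunP/(_ (Sub j jJ)) := cJE; rewrite !ffunE /= => ij.
  have := subcube_centerB b i i' j u0; rewrite ij subrr mulr0.
  have := ctr j _ _ yi; have := ctr j _ _ yi'; rewrite !ltr_norml ler_norml.
  rewrite [(y - y') 0 j]mxE [(- y') 0 j]mxE.
  by move=> /andP[? ?] /andP[? ?] ?; apply/andP; split; lra.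
have yy' := JP _ _ yV (mulr_ge0 (ler0n _ 4) (ltW h0)) yJ.
apply/ffunP => l; apply/val_inj.
(* The centres differ by less than [3 ^ k * (4 * h) + 2 * h + 2 * h] in coordinate [l], and by
   [2 * h] per unit of index; the quotient is [2 * 3 ^ k + 2]. *)
have : `|(i l)%:R - (i' l)%:R| < M%:R :> R.
  have := subcube_centerB b i i' l u0; rewrite -/h.
  have := ctr l _ _ yi; have := ctr l _ _ yi'.
  have := le_trans (coord_le_norm _ l) yy'; rewrite !ltr_norml ler_norml.
  rewrite [(y - y') 0 l]mxE [(- y') 0 l]mxE.
  have -> : M%:R = 2 * 3 ^+ k + 2 :> R.
    by rewrite /M -natr1 natr_double_succ natrX -addrA.
  move=> /andP[? ?] /andP[? ?] /andP[? ?] E.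
  apply/andP; split; rewrite -(ltr_pM2l (mulr_gt0 (ltr0n _ 2) h0)); lra.
have /ffunP/(_ l) := cME; rewrite !ffunE => /(congr1 (@nat_of_ord _)).
rewrite !inordK ?ltn_mod// => iM.
rewrite ltr_norml => /andP[]; rewrite ltrBrDl !ltrBlDr -!natrD !ltr_nat => lo hi.
by apply: (@eq_modn_close M) => //; rewrite addnC.
Qed.

Lemma card_splitting_near (k u : nat) (b : box R N) (mv : alice_move R N) :
  (0 < u)%N -> legal_move k u%:R^-1 mv ->
  @card_at_most R _
    [set b' | canonical_splitting b u b' /\ box_set b' `&` deleted b mv !=set0]
    (u ^ k * (3 ^ k).*2.+2 ^ N)%:R.
Proof.
move=> u0 lm; exists (u ^ k * (3 ^ k).*2.+2 ^ N)%N; split=> //.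
have u0' : 0 < u%:R :> R by rewrite ltr0n.
pose f (i : {ffun 'I_N -> 'I_u}) : box R N :=
  Box (subcube_center b i) (divr_gt0 (box_rad_gt0 b) u0').
pose X := [pred i | `[< box_set (f i) `&` deleted b mv !=set0 >]].
have cX : (#|X| <= u ^ k * (3 ^ k).*2.+2 ^ N)%N.
  rewrite (leq_trans _ (card_subcubes_near b u0 lm))//.
  apply/subset_leq_card/fintype.subsetP => i; rewrite !inE => -[x [xi xd]].
  by exists x.
pose g n := f (nth [ffun=> Ordinal u0] (enum X) n).
apply: (@card_le_trans _ _ _ (g @` `I_#|X|)); last first.
  by rewrite (card_le_trans (card_image_le _ _))// card_le_II.
apply: subset_card_le => b' [[b'r [i b'c]] b'd].
have b'E : b' = f (finfun i).
  apply: box_eq => //=; rewrite b'c; apply/rowP => j; rewrite !mxE ffunE//.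
have iX : finfun i \in enum X.
  by rewrite mem_enum; apply/asboolP; rewrite -b'E.
exists (index (finfun i) (enum X)); first by rewrite /= cardE index_mem.
by rewrite /g nth_index.
Qed.
End Counting.

(** * The [u]-adic grid of [B] and the boxes surviving Alice's answers *)

Section Grid.
Variables (R : realType) (N u : nat) (B : box R N) (u0 : (0 < u)%N).
Implicit Types (a : 'I_N -> nat) (b : box R N).

Let u_neq0 : u%:R != 0 :> R. Proof. by rewrite pnatr_eq0 -lt0n. Qed.

Lemma splitting_sub b b' :
  canonical_splitting b u b' -> box_set b' `<=` box_set b.
Proof.
move=> [r' [i c']] x; rewrite /box_set/= => xb'.
have r0 := box_rad_gt0 b.
apply/norm_leP => [|j]; first exact: ltW.
have := le_trans (coord_le_norm _ j) xb'.
rewrite r' c' !mxE natr_double_succ => xj.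
have iu : box_rad b * (i j)%:R / u%:R + box_rad b / u%:R <= box_rad b.
  rewrite -mulrDl -[X in _ + X]mulr1 -mulrDr natr1 ler_pdivrMr ?ltr0n//.
  by rewrite ler_wpM2l ?ler_nat// ltW.
have i0 : 0 <= box_rad b * (i j)%:R / u%:R.
  by rewrite divr_ge0// mulr_ge0// ltW.
have E : box_rad b * (2 * (i j)%:R + 1) / u%:R =
   2 * (box_rad b * (i j)%:R / u%:R) + box_rad b / u%:R by field.
move: xj; rewrite E !ler_norml => /andP[? ?]; apply/andP; split; lra.
Qed.

Fact grid_rad_gt0 n : 0 < box_rad B / (u ^ n)%:R.
Proof. by rewrite divr_gt0 ?box_rad_gt0// ltr0n expn_gt0 u0. Qed.

(** Indices of all levels share one type, so the grid is a single tree to which [konig] applies.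
    Large entries give boxes not inside [B], but these do not descend from the zero index at level
    0. *)
Definition gridbox n a : box R N :=
  Box (\row_j (box_center B 0 j - box_rad B
               + box_rad B * (a j).*2.+1%:R / (u ^ n)%:R)) (grid_rad_gt0 n).

Definition parent a : 'I_N -> nat := fun j => (a j %/ u)%N.

Lemma gridbox0 : gridbox 0 (fun=> 0%N) = B.
Proof.
apply: box_eq; rewrite /= ?expn0 ?divr1//.
by apply/rowP => j; rewrite mxE mulr1 subrK.
Qed.

Lemma gridbox_inj n : injective (gridbox n).
Proof.
move=> a a' /(congr1 (@box_center R N))/rowP E; apply/funext => j.
have := E j; rewrite !mxE => /addrI.
have U0 : (u ^ n)%:R^-1 != 0 :> R by rewrite invr_neq0// pnatr_eq0 -lt0n expn_gt0 u0.
move=> /(mulIf U0)/(mulfI (lt0r_neq0 (box_rad_gt0 B)))/eqP.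
by rewrite eqr_nat eqSS => /eqP/double_inj.
Qed.

(** Passing to a subcube appends one base-[u] digit to each entry of the index, and [parent] drops
    it again. *)
Lemma splitting_gridbox n a :
  canonical_splitting (gridbox n a) u =
  [set gridbox n.+1 a' | a' in [set a' | parent a' = a]].
Proof.
have U0 : (u ^ n)%:R != 0 :> R by rewrite pnatr_eq0 -lt0n expn_gt0 u0.
have ctr (i : 'I_N -> 'I_u) : subcube_center (gridbox n a) i =
    box_center (gridbox n.+1 (fun j => (a j * u + i j)%N)).
  apply/rowP => j; rewrite !mxE/= !natr_double_succ natrD natrM expnSr natrM.
  by field; rewrite ?U0 ?u_neq0.
have rad : box_rad B / (u ^ n)%:R / u%:R = box_rad B / (u ^ n.+1)%:R.
  by rewrite expnSr natrM invfM mulrA.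
apply/seteqP; split=> [b [/= br [i bc]]|_ [a' a'E <-]].
  exists (fun j => (a j * u + i j)%N).
    by apply/funext => j; rewrite /parent divnMDl// divn_small// addn0.
  by apply: box_eq; rewrite /= ?br//= bc ctr.
split; first by rewrite /= rad.
exists (fun j => Ordinal (ltn_pmod (a' j) u0)); rewrite ctr; congr box_center.
by congr gridbox; apply/funext => j /=; rewrite -a'E -divn_eq.
Qed.

Lemma gridbox_sub n a : box_set (gridbox n.+1 a) `<=` box_set (gridbox n (parent a)).
Proof. by apply: splitting_sub; rewrite splitting_gridbox; exists a. Qed.

Lemma parent_child a :
  exists i : {ffun 'I_N -> 'I_u}, a = fun j => (parent a j * u + i j)%N.
Proof.
exists [ffun j => Ordinal (ltn_pmod (a j) u0)].
by apply/funext => j; rewrite ffunE /= -divn_eq.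
Qed.

Variable s : strategy R N.

(** The chain of ancestors is read as Bob's play, oldest box first, so Alice's answer depends only
    on the node reached. *)
Definition history n a : seq (box R N) :=
  mkseq (fun m => gridbox m (iter (n - m) parent a)) n.+1.

Definition hit n a :=
  box_set (gridbox n.+1 a)
    `&` deleted (gridbox n (parent a)) (s (history n (parent a))) !=set0.

Fixpoint kept n : set ('I_N -> nat) :=
  if n is m.+1 then [set a | kept m (parent a) /\ ~ hit m a] else [set fun=> 0%N].

Definition level n : set (box R N) := gridbox n @` kept n.

Lemma cantor_construction_level k (r : nat -> nat -> R) :
  (forall m n, 0 <= r m n) ->
  (forall n, (u ^ k * (3 ^ k).*2.+2 ^ N)%:R <= r n n) ->
  (forall h, legal_move k u%:R^-1 (s h)) ->
  cantor_construction B u r level.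
Proof.
move=> r0 rk sk.
(* The removal with [m = n] comes first and already yields [level n.+1]; every later one removes an
   empty family. *)
exists (fun n m => if m == n.+1 then \bigcup_(b in level n) canonical_splitting b u
                   else level n.+1).
split; first by rewrite /level image_set1 gridbox0.
move=> n; rewrite eqxx; split=> // m.
rewrite leq_eqVlt => /orP[/eqP ->|mn]; last first.
  rewrite !ltn_eqF ?ltnS// 1?ltnW//; exists (fun=> set0); split.
    move=> b _; split=> //; exists 0%N; split; last exact: r0.
    by rewrite II0 card_le0.
  by rewrite bigcup0// setD0.
rewrite eqxx (ltn_eqF (ltnSn n)) subnn expn1.
(* From each box, the children hit by Alice's answer to its own history are removed. *)
exists (fun b => [set b' | exists2 a, b' = gridbox n.+1 a
                          & b = gridbox n (parent a) /\ hit n a]).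
split=> [_ [a ka <-]|].
  split=> [_ [a' -> [/gridbox_inj aE ha']]|].
    have spl : canonical_splitting (gridbox n a) u (gridbox n.+1 a').
      by rewrite splitting_gridbox; exists a'.
    by split=> //; exists (gridbox n a) => //; exists a.
  have [c [cA cr]] := card_splitting_near (gridbox n a) u0 (sk (history n a)).
  exists c; split; last exact: le_trans (rk n).
  apply: card_le_trans cA; apply: subset_card_le => _ [a' -> [/gridbox_inj aE ha']].
  split; first by rewrite splitting_gridbox; exists a'.
  by rewrite aE.
apply/seteqP; split=> [_ [a [ka ha] <-]|b [[_ [a ka <-]]]].
  split.
    exists (gridbox n (parent a)); first by exists (parent a).
    by rewrite splitting_gridbox; exists a.
  by move=> [b _ [a' /gridbox_inj <- [_ /ha]]].
rewrite splitting_gridbox => -[a' a'E <-] nb; exists a' => //; split; first by rewrite a'E.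
by move=> ha'; apply: nb; exists (gridbox n a); [exists a|exists a' => //; rewrite a'E].
Qed.

(** A point on a common boundary lies in several boxes of one level, so boxes containing [x] picked
    level by level need not be nested; [konig] selects a nested chain. *)
Lemma level_cantor_sub (E : set 'rV[R]_N) : (1 < u)%N ->
  (forall b : nat -> box R N, bob_plays_against u%:R^-1 s b ->
      (\bigcap_i box_set (b i)) `&` E !=set0) ->
  \bigcap_n \bigcup_(b in level n) box_set b `<=` E.
Proof.
move=> u1 sE x xC.
have [||||f fP] := @konig _ _ parent
  (fun a (i : {ffun 'I_N -> 'I_u}) j => (a j * u + i j)%N)
  (fun n => [set a | kept n a /\ box_set (gridbox n a) x]) (fun=> 0%N).
- exact: parent_child.
- by move=> n a [[ka _] /gridbox_sub].
- by move=> a [].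
- by move=> n; have [_ [a ka <-] xa] := xC n I; exists a.
have fpar n : parent (f n.+1) = f n by have [] := fP n.
(* Along the branch the ancestors of [f n] are the earlier [f m], so the tree's history is the list
   that [answer] feeds to the strategy. *)
have hist n : history n (f n) = mkseq (fun m => gridbox m (f m)) n.+1.
  apply/eq_in_map => m; rewrite mem_iota add0n ltnS => /andP[_ mn].
  congr gridbox; elim: n mn => [|n IH]; first by rewrite leqn0 => /eqP->.
  rewrite leq_eqVlt => /predU1P[->|mn]; first by rewrite subnn.
  by rewrite subSn// iterSr fpar IH.
have [|y [yb Ey]] := sE (fun n => gridbox n (f n)).
  move=> n; split.
    move=> z zb; split; first by rewrite -fpar; exact: gridbox_sub.
    (* A point of the next box in the deleted set would make [f n.+1] hit, although it is kept. *)
    move=> zd; have [[[_ +] _] _] := fP n.+1; apply; exists z; split=> //.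
    by rewrite fpar hist.
  by rewrite [leLHS]mulrC /= expnSr natrM invfM mulrA.
suff -> : x = y by [].
(* Both points lie in a box of radius [box_rad B / u ^ n], where
   [u ^ n >= n > 2 * box_rad B / e]. *)
apply/eqP; rewrite -subr_eq0 -normr_le0; apply/ler_addgt0Pl => e e0.
rewrite addr0; pose n := Num.bound (2 * box_rad B / e).
have [[_ /= xn] _] := fP n; have /= yn := yb n I.
rewrite /box_set/= in xn yn.
set c := (\row_j _) in xn yn.
rewrite -(subrKA c x (- y)) (le_trans (ler_normD _ _))// (distrC c y).
rewrite (le_trans (lerD xn yn))// -mulrDl ler_pdivrMr ?ltr0n ?expn_gt0 ?u0//.
have : 2 * box_rad B / e < n%:R.
  by apply: archi_boundP; rewrite divr_ge0 ?mulr_ge0// ltW// box_rad_gt0.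
have : n%:R <= (u ^ n)%:R :> R by rewrite ler_nat ltnW// ltn_expl.
move=> nu; rewrite ltr_pdivrMr// => nr.
have : n%:R * e <= (u ^ n)%:R * e by rewrite ler_wpM2r// ltW.
by lra.
Qed.

End Grid.

Theorem theorem12 (R : realType) (N k : nat) (hN : (1 <= N)%N)
    (hk : (k <= N - 1)%N) (E : set 'rV[R]_N) :
  absolute_winning k E -> cantor_winning ((N%:R - k%:R) / N%:R) E.
Proof.
move=> Ewin B eps eps0 epsN.
have N0 : 0 < N%:R :> R by rewrite ltr0n.
(* The surplus of the available exponent over [k]; the bound on [eps] makes it positive. *)
pose g : R := N%:R * (1 - eps) - k%:R.
have g0 : 0 < g.
  by move: epsN; rewrite /g ltr_pdivlMr// => ?; lra.
pose M := ((3 ^ k).*2.+2 ^ N)%N.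
(* The 4 puts [1 / u] below [1 / 3]; the other bound gives [M <= u ^ g], hence
   [u ^ k * M <= u ^ (k + g)]. *)
exists (maxn 4 (Num.bound (M%:R `^ g^-1))) => u u0; rewrite geq_max => /andP[u4 uM].
have uR : 0 < u%:R :> R by rewrite ltr0n.
have beta0 : 0 < u%:R^-1 :> R by rewrite invr_gt0.
have beta3 : u%:R^-1 < 3^-1 :> R by rewrite ltf_pV2 ?posrE// ltr_nat.
have [s [sk sE]] := Ewin _ beta0 beta3.
exists (\bigcap_n \bigcup_(b in level B u0 s n) box_set b); split; last first.
  by apply: level_cantor_sub sE; exact: leq_trans u4.
exists (level B u0 s); split=> //.
apply: cantor_construction_level sk => [m n|n]; first exact: powR_ge0.
rewrite subnn mul1r /splitting_size natrX -powR_mulrn ?ler0n// -powRrM.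
have -> : N%:R * (1 - eps) = k%:R + g by rewrite /g; ring.
rewrite powRD; last by rewrite (gt_eqF uR) implybT.
rewrite natrM natrX powR_mulrn ?ler0n// ler_wpM2l ?exprn_ge0//.
have Mu : M%:R `^ g^-1 <= u%:R :> R.
  rewrite ltW// (lt_le_trans (archi_boundP (powR_ge0 _ _)))// ler_nat//.
have := ge0_ler_powR (ltW g0) (powR_ge0 _ _) (ltW uR) Mu.
by rewrite -powRrM mulVf ?gt_eqF// powRr1.
Qed.
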